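(* Let $F$ be an infinite field, $G$ a group with unit $e$, $n\ge 1$, and let $M_n(F)$ be endowed with the elementary $G$-grading defined by an $n$-tuple $(g_1,\dots,g_n)\in G^n$ of pairwise distinct elements and with the transpose involution. Let $U$ be the $T_G^*$-ideal of $F\langle X\,|\,(G,* )\rangle$ generated by the polynomials (1) $x_{1,e}x_{2,e}-x_{2,e}x_{1,e}$, (2) $x_{1,e}-x_{1,e}^{*}$, (3) $x_{1,g}$ for all $g\in G\setminus \mathrm{Supp}(M_n(F))$, together with all monomials of degree at most $2n-1$ in $F\langle X\,|\,(G,* )\rangle$ that are $(G,* )$-identities of $M_n(F)$. Then \[T_G^*(M_n(F))=U.\]
   Context: $F$ is an infinite field of arbitrary characteristic. The elementary grading on $M_n(F)$ defined by $(g_1,\dots,g_n)$ is $M_n(F)=\bigoplus_{g\in G}R_g$, where $R_g$ is the span of the matrix units $e_{ij}$ with $g_i^{-1}g_j=g$. The support of a graded algebra $A=\bigoplus_g A_g$ is $\mathrm{Supp}(A)=\{g\in G: A_g\ne 0\}$. A $(G,* )$-algebra is a $G$-graded algebra $A=\bigoplus_g A_g$ with an involution $*$ (linear antiautomorphism of order two) such that $(A_g)^*=A_{g^{-1}}$ for all $g$. $M_n(F)$ with an elementary grading and the transpose is a $(G,* )$-algebra. The free $(G,* )$-algebra $F\langle X\,|\,(G,* )\rangle$ is the free unital associative algebra on the variables $x_{k,g}$ and $x_{k,g}^*$ ($k\in\mathbb N$, $g\in G$), with the obvious involution interchanging $x_{k,g}$ and $x_{k,g}^*$, graded by $\deg(1)=e$,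 $\deg(x_{k,g})=g$, $\deg(x_{k,g}^* )=g^{-1}$, the degree of a monomial being the product of the degrees of its letters in order. (In ''monomials of degree at most $2n-1$'', degree means length.) Homomorphisms of graded algebras with involution are algebra homomorphisms preserving the grading and commuting with $*$. A $(G,* )$-identity of a $(G,* )$-algebra $A$ is an $f\in F\langle X\,|\,(G,* )\rangle$ lying in the kernel of every homomorphism of graded algebras with involution $F\langle X\,|\,(G,* )\rangle\to A$ (i.e. $f$ vanishes whenever each $x_{k,g}$ is replaced by some $a\in A_g$ and $x_{k,g}^*$ by $a^*$). $T_G^*(A)$ is the set of all $(G,* )$-identities of $A$. A $T_G^*$-ideal is a two-sided ideal of $F\langle X\,|\,(G,* )\rangle$ closed under all endomorphisms of graded algebras with involution; the $T_G^*$-ideal generated by a set $S$ is the intersection of all $T_G^*$-ideals containing $S$. *)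

(* Defs.v *)
From HB Require Import structures.
From mathcomp Require Import all_boot all_order all_algebra.
From mathcomp Require Import finmap.
From mathcomp.multinomials Require Import monalg.

Set Implicit Arguments.
Unset Strict Implicit.
Unset Printing Implicit Defensive.

Import GRing.Theory.
Local Open Scope ring_scope.

Definition infinite_type (T : eqType) : Prop :=
  forall s : seq T, exists x, x \notin s.

(* [gs_full] and [gs_indep] say that the algebra is the direct sum of its
   components; since the involution is bijective, [gs_starG] amounts to
   (A_g)^* = A_{g^-1}. *)
Record gsAlgebra (F : fieldType) (G : groupType) := GsAlgebra {
  gs_sort :> algType F;
  gs_comp : G -> gs_sort -> Prop;
  gs_star : gs_sort -> gs_sort;
  gs_comp0 : forall g, gs_comp g 0;
  gs_compP : forall g a x y,
    gs_comp g x -> gs_comp g y -> gs_comp g (a *: x + y);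
  gs_compM : forall g h x y,
    gs_comp g x -> gs_comp h y -> gs_comp (g * h)%g (x * y);
  gs_full : forall x, exists s : seq G, exists2 c : G -> gs_sort,
    (forall g, gs_comp g (c g)) & x = \sum_(g <- s) c g;
  gs_indep : forall (s : seq G) (c : G -> gs_sort), uniq s ->
    (forall g, gs_comp g (c g)) -> \sum_(g <- s) c g = 0 ->
    forall g, g \in s -> c g = 0;
  gs_starP : forall a x y, gs_star (a *: x + y) = a *: gs_star x + gs_star y;
  gs_starM : forall x y, gs_star (x * y) = gs_star y * gs_star x;
  gs_starK : involutive gs_star;
  gs_starG : forall g x, gs_comp g^-1%g (gs_star x) <-> gs_comp g x
}.

Arguments gs_comp {F G} A g x : rename.
Arguments gs_star {F G} A x : rename.

Section GradedInvolution.
Variables (F : fieldType) (G : groupType).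
Implicit Types A B : gsAlgebra F G.

Definition gs_supp A (g : G) : Prop := exists2 x, gs_comp A g x & x <> 0.

Definition gs_hom A B (phi : {lrmorphism A -> B}) : Prop :=
  (forall g x, gs_comp A g x -> gs_comp B g (phi x)) /\
  (forall x, phi (gs_star A x) = gs_star B (phi x)).

Definition two_sided_ideal (R : pzRingType) (I : R -> Prop) : Prop :=
  [/\ I 0, forall x y, I x -> I y -> I (x + y),
      forall a x, I x -> I (a * x) & forall a x, I x -> I (x * a)].

Definition gs_Tideal A (I : A -> Prop) : Prop :=
  two_sided_ideal I /\
  forall phi : {lrmorphism A -> A}, gs_hom phi -> forall x, I x -> I (phi x).

Definition gs_Tideal_gen A (S : A -> Prop) (x : A) : Prop :=
  forall I : A -> Prop, gs_Tideal I -> (forall y, S y -> I y) -> I x.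

End GradedInvolution.

Section Free.
Variables (F : fieldType) (G : groupType).

(* [(k, g, false)] stands for the variable x_{k,g}, [(k, g, true)] for
   x_{k,g}^*. *)
Definition letter : choiceType := (nat * G * bool)%type.

Definition letter_deg (l : letter) : G := if l.2 then (l.1.2^-1)%g else l.1.2.

Definition letter_star (l : letter) : letter := (l.1, ~~ l.2).

Definition word_deg (w : {fmonom letter}) : G := (\prod_(l <- w) letter_deg l)%g.

Definition word_star (w : {fmonom letter}) : {fmonom letter} :=
  FMonom (rev (map letter_star w)).

(* The library equips [malg] with an [algType] structure only over commutative
   monoids, hence the alias. *)
Definition free_alg : Type := {malg F[{fmonom letter}]}.

HB.instance Definition _ := GRing.Lalgebra.on free_alg.

Lemma free_scaleAr (a : F) (x y : free_alg) : a *: (x * y) = x * (a *: y).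
Proof.
suff E (z : {malg F[{fmonom letter}]}) : a *: z = z * a%:MP.
  rewrite ![in LHS](E (x * y)) -mulrA; congr (_ * _); exact/esym/E.
rewrite malgM_def fgmulgU; apply/malgP => k.
rewrite mcoeffZ {1}[z]monalgE !raddf_sum mulr_sumr; apply: eq_bigr => i _.
by rewrite /= mulm1 !mcoeffU mulrnAr mulrC.
Qed.

HB.instance Definition _ := GRing.Lalgebra_isAlgebra.Build F free_alg free_scaleAr.

Definition free_comp (g : G) (f : free_alg) : Prop :=
  forall w, w \in msupp f -> word_deg w = g.

Definition free_star (f : free_alg) : free_alg :=
  \sum_(w <- msupp f) << f@_w *g word_star w >>.

Definition xvar (k : nat) (g : G) : free_alg := << fmu ((k, g, false) : letter) >>.
Definition xvars (k : nat) (g : G) : free_alg := << fmu ((k, g, true) : letter) >>.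
Definition xmon (w : {fmonom letter}) : free_alg := << w >>.

Lemma word_starK : involutive word_star.
Proof.
case=> s; rewrite /word_star /=; congr FMonom.
rewrite map_rev revK -map_comp map_id_in // => -[l b] _.
by rewrite /letter_star /= negbK.
Qed.

Lemma word_starM v w : word_star (mmul v w) = mmul (word_star w) (word_star v).
Proof.
by apply: val_inj; rewrite /= !fmM /= map_cat rev_cat.
Qed.

Lemma word_degM v w : word_deg (mmul v w) = (word_deg v * word_deg w)%g.
Proof. by rewrite /word_deg fmM big_cat. Qed.

Lemma word_deg_star w : word_deg (word_star w) = (word_deg w)^-1%g.
Proof.
rewrite /word_deg /= -map_rev big_map.
rewrite (_ : (\prod_(l <- w) _)%g = (\prod_(l <- rev (rev w)) letter_deg l)%g).
  rewrite -prodgV; apply: eq_bigr => -[[k g] []] _ //.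
  by rewrite /letter_deg /= invgK.
by rewrite revK.
Qed.

Lemma free_starE f w : (free_star f : {malg F[{fmonom letter}]})@_w = f@_(word_star w).
Proof.
rewrite /free_star {3}[f]monalgE !raddf_sum; apply: eq_bigr => v _ /=.
by rewrite !mcoeffU (can2_eq word_starK word_starK).
Qed.

Lemma free_comp0 g : free_comp g 0.
Proof. by move=> w; rewrite msupp0 in_fset0. Qed.

Lemma free_compE g f : free_comp g f <-> forall w, f@_w != 0 -> word_deg w = g.
Proof. by split=> H w; [rewrite mcoeff_neq0|rewrite -mcoeff_neq0]; apply: H. Qed.

Lemma free_compP g a x y :
  free_comp g x -> free_comp g y -> free_comp g (a *: x + y).
Proof.
move=> /free_compE Hx /free_compE Hy; apply/free_compE => w.
rewrite mcoeffD mcoeffZ => nz.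
have [x0|/Hx//] := eqVneq (x@_w) 0; apply: Hy.
by apply: contraNneq nz => ->; rewrite x0 mulr0 addr0.
Qed.

Lemma free_compM g h x y :
  free_comp g x -> free_comp h y -> free_comp (g * h)%g (x * y).
Proof.
move=> Hx Hy w /msuppM_le [v1] [v2] [v1x v2y ->].
by rewrite word_degM (Hx _ v1x) (Hy _ v2y).
Qed.

Definition free_proj (f : free_alg) (g : G) : free_alg :=
  \sum_(w <- msupp f | word_deg w == g) << f@_w *g w >>.

Lemma free_projE f g w :
  (free_proj f g : {malg F[{fmonom letter}]})@_w
  = if word_deg w == g then f@_w else 0.
Proof.
rewrite /free_proj raddf_sum /=.
rewrite (eq_bigr (fun v => f@_v *+ (v == w))); last by move=> v _; rewrite mcoeffU.
case: ifP => wg; last first.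
  by rewrite big1 // => v /eqP vg; case: eqP => // vw; move: wg; rewrite -vw vg eqxx.
have [fw|fw] := msuppP f w; last first.
  rewrite big_seq_cond big1 // => v /andP[vf _].
  by case: eqP => // vw; rewrite -vw vf in fw.
rewrite big_mkcond (big_fsetD1 w) //= wg eqxx mulr1n big_seq_cond big1 ?addr0 // => v.
by rewrite andbT in_fsetD1 => /andP[/negbTE-> _]; rewrite if_same.
Qed.

Lemma free_full f : exists s : seq G, exists2 c : G -> free_alg,
  (forall g, free_comp g (c g)) & f = \sum_(g <- s) c g.
Proof.
pose s := undup [seq word_deg w | w <- msupp f]; exists s; exists (free_proj f).
  move=> g; apply/free_compE => w; rewrite free_projE.
  by case: (word_deg w =P g) => // _; rewrite eqxx.
apply/malgP => w; rewrite raddf_sum /=.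
under eq_bigr do rewrite free_projE.
have [fw|fw] := msuppP f w; last by rewrite big1 // => g _; rewrite if_same.
rewrite (bigD1_seq (word_deg w)) ?undup_uniq //=; last first.
  by rewrite mem_undup map_f.
by rewrite eqxx big1 ?addr0 // => g; rewrite eq_sym => /negbTE->.
Qed.

Lemma free_indep (s : seq G) (c : G -> free_alg) : uniq s ->
  (forall g, free_comp g (c g)) -> \sum_(g <- s) c g = 0 ->
  forall g, g \in s -> c g = 0.
Proof.
move=> us Hc sum0 g gs; apply/malgP => w; rewrite mcoeff0.
have [wg|wg] := eqVneq (word_deg w) g; last first.
  by apply/eqP; apply: contraNT wg => nz; apply/eqP/(proj1 (free_compE _ _) (Hc g)).
have := congr1 (mcoeff w) sum0; rewrite mcoeff0 raddf_sum (bigD1_seq g) //=.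
rewrite big1 ?addr0 // => h hg; apply/eqP; apply: contraNT hg => nz.
by rewrite -wg; apply/eqP/esym/(proj1 (free_compE _ _) (Hc h)).
Qed.

Lemma free_starP a x y :
  free_star (a *: x + y) = a *: free_star x + free_star y.
Proof.
by apply/malgP => w; rewrite mcoeffD mcoeffZ !free_starE mcoeffD mcoeffZ.
Qed.

Lemma free_starK : involutive free_star.
Proof. by move=> x; apply/malgP => w; rewrite !free_starE word_starK. Qed.

Lemma free_star_sum (I : Type) (r : seq I) (E : I -> free_alg) :
  free_star (\sum_(i <- r) E i) = \sum_(i <- r) free_star (E i).
Proof.
apply: (big_morph free_star) => [x y|].
  by have := free_starP 1 x y; rewrite !scale1r.
by apply/malgP => w; rewrite free_starE !mcoeff0.
Qed.

Lemma free_starU a (w : {fmonom letter}) :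
  free_star << a *g w >> = << a *g word_star w >>.
Proof.
apply/malgP => v; rewrite free_starE !mcoeffU.
by rewrite (can2_eq word_starK word_starK).
Qed.

Lemma free_starM x y : free_star (x * y) = free_star y * free_star x.
Proof.
rewrite [x in LHS]monalgE [y in LHS]monalgE mulr_suml free_star_sum.
rewrite [free_star x]/free_star mulr_sumr; apply: eq_bigr => v _.
rewrite mulr_sumr free_star_sum /free_star mulr_suml; apply: eq_bigr => w _.
rewrite !malgM_def !fgmulUU -word_starM mulrC; exact: free_starU.
Qed.

Lemma free_starG g x : free_comp g^-1%g (free_star x) <-> free_comp g x.
Proof.
split=> /free_compE H; apply/free_compE => w nz.
  apply: invg_inj; rewrite -word_deg_star; apply: H.
  by rewrite free_starE word_starK.
by rewrite -[w]word_starK word_deg_star H // -free_starE.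
Qed.

Definition freeGS : gsAlgebra F G :=
  GsAlgebra free_comp0 free_compP free_compM free_full free_indep
    free_starP free_starM free_starK free_starG.

End Free.

Definition gs_identity (F : fieldType) (G : groupType) (A : gsAlgebra F G)
    (f : freeGS F G) : Prop :=
  forall phi : {lrmorphism freeGS F G -> A}, gs_hom phi -> phi f = 0.

(* The matrix size is written [n.+1] because 'M_n is an [algType] only for
   nonzero sizes. *)
Section Elementary.
Variables (F : fieldType) (G : groupType) (n : nat) (t : 'I_n.+1 -> G).

Definition elem_comp (g : G) (x : 'M[F]_n.+1) : Prop :=
  exists c : 'I_n.+1 -> 'I_n.+1 -> F,
    x = \sum_i \sum_(j | ((t i)^-1 * t j)%g == g) c i j *: delta_mx i j.

Lemma elem_compE g x :
  elem_comp g x <-> forall i j, x i j != 0 -> ((t i)^-1 * t j)%g = g.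
Proof.
have E (c : 'I_n.+1 -> 'I_n.+1 -> F) i j :
    (\sum_i \sum_(j | ((t i)^-1 * t j)%g == g) c i j *: delta_mx i j) i j
    = if ((t i)^-1 * t j)%g == g then c i j else 0.
  rewrite summxE (bigD1 i) //= [X in _ + X]big1 ?addr0; last first.
    move=> k ki; rewrite summxE big1 // => l _.
    by rewrite !mxE eq_sym (negbTE ki) mulr0.
  rewrite summxE big_mkcond (bigD1 j) //= big1 ?addr0.
    by rewrite !mxE !eqxx mulr1.
  move=> l lj; case: ifP => // _.
  by rewrite !mxE eqxx /= eq_sym (negbTE lj) mulr0.
split=> [[c ->] i j|H].
  by rewrite E; case: ((_ * _)%g =P g) => // _; rewrite eqxx.
exists (fun i j => x i j); apply/matrixP => i j; rewrite E.
by case: eqP => // ne; apply/eqP; apply: contraPT isT => /H.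
Qed.

Lemma elem_comp0 g : elem_comp g 0.
Proof. by apply/elem_compE => i j; rewrite mxE eqxx. Qed.

Lemma elem_compP g a x y :
  elem_comp g x -> elem_comp g y -> elem_comp g (a *: x + y).
Proof.
move=> /elem_compE Hx /elem_compE Hy; apply/elem_compE => i j; rewrite !mxE => nz.
have [x0|/Hx//] := eqVneq (x i j) 0; apply: Hy.
by apply: contraNneq nz => ->; rewrite x0 mulr0 addr0.
Qed.

Lemma elem_compM g h x y :
  elem_comp g x -> elem_comp h y -> elem_comp (g * h)%g (x * y).
Proof.
move=> /elem_compE Hx /elem_compE Hy; apply/elem_compE => i j; rewrite mxE => nz.
have [k] : exists k, x i k * y k j != 0.
  apply/existsP; apply: contraNT nz => /existsPn H.
  by rewrite big1 // => k _; apply/eqP; rewrite -[_ == _]negbK H.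
rewrite mulf_eq0 negb_or => /andP[/Hx <- /Hy <-].
by rewrite !mulgA mulgK.
Qed.

Lemma elem_full x : exists s : seq G, exists2 c : G -> 'M[F]_n.+1,
  (forall g, elem_comp g (c g)) & x = \sum_(g <- s) c g.
Proof.
pose d (i j : 'I_n.+1) : G := ((t i)^-1 * t j)%g.
exists (undup [seq d p.1 p.2 | p : 'I_n.+1 * 'I_n.+1]).
exists (fun g => \matrix_(i, j) if d i j == g then x i j else 0).
  by move=> g; apply/elem_compE => i j; rewrite mxE; case: (d i j =P g) => // _; rewrite eqxx.
apply/matrixP => i j; rewrite summxE.
rewrite (bigD1_seq (d i j)) ?undup_uniq //=; last first.
  by rewrite mem_undup; apply/imageP; exists (i, j).
rewrite mxE eqxx big1 ?addr0 // => g; rewrite mxE eq_sym.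
by move/negbTE->.
Qed.

Lemma elem_indep (s : seq G) (c : G -> 'M[F]_n.+1) : uniq s ->
  (forall g, elem_comp g (c g)) -> \sum_(g <- s) c g = 0 ->
  forall g, g \in s -> c g = 0.
Proof.
move=> us Hc sum0 g gs; apply/matrixP => i j; rewrite mxE.
have [wg|wg] := eqVneq ((t i)^-1 * t j)%g g; last first.
  by apply/eqP; apply: contraNT wg => nz; apply/eqP/(proj1 (elem_compE _ _) (Hc g)).
have := congr1 (fun y : 'M_n.+1 => y i j) sum0; rewrite mxE summxE (bigD1_seq g) //=.
rewrite big1 ?addr0 // => h hg; apply/eqP; apply: contraNT hg => nz.
by rewrite -wg; apply/eqP/esym/(proj1 (elem_compE _ _) (Hc h)).
Qed.

Lemma elem_starP a (x y : 'M[F]_n.+1) : (a *: x + y)^T = a *: x^T + y^T.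
Proof. by rewrite linearP. Qed.

Lemma elem_starM (x y : 'M[F]_n.+1) : (x * y)^T = y^T * x^T.
Proof. exact: trmx_mul. Qed.

Lemma elem_starG g x : elem_comp g^-1%g x^T <-> elem_comp g x.
Proof.
split=> /elem_compE H; apply/elem_compE => i j nz.
  by apply: invg_inj; rewrite -(H j i) ?mxE // invgM invgK.
by rewrite mxE in nz; rewrite -(H _ _ nz) invgM invgK.
Qed.

Definition elemGS : gsAlgebra F G :=
  @GsAlgebra F G 'M[F]_n.+1 elem_comp trmx elem_comp0 elem_compP elem_compM
    elem_full elem_indep elem_starP elem_starM (@trmxK _ _ _) elem_starG.

Inductive elem_gens : freeGS F G -> Prop :=
| gens_comm :
    elem_gens (xvar F 1 1%g * xvar F 2 1%g - xvar F 2 1%g * xvar F 1 1%g)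
| gens_sym : elem_gens (xvar F 1 1%g - xvars F 1 1%g)
| gens_supp g : ~ gs_supp elemGS g -> elem_gens (xvar F 1 g)
| gens_mon w : (fdeg w <= 2 * n.+1 - 1)%N ->
    gs_identity elemGS (xmon F w) -> elem_gens (xmon F w).

End Elementary.

Arguments elem_gens F {G n} t _.

(* Main.v *)
Require Import Defs.
From HB Require Import structures.
From mathcomp Require Import all_boot all_order all_algebra.
From mathcomp Require Import finmap.
From mathcomp.multinomials Require Import monalg.
From mathcomp Require Import zify.

Set Implicit Arguments.
Unset Strict Implicit.
Unset Printing Implicit Defensive.

Import GRing.Theory.
Local Open Scope ring_scope.

(** Substituting generic matrices into a word gives, in entry (i, j), the
    monomial of the edges of the walk labelled by the word from g_i to g_j in the
    Cayley graph of G, restricted to the vertices g_1, ..., g_n, and zero if the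
    walk leaves these vertices. As F is infinite, an identity is congruent to zero
    modulo U once words with the same starting point and the same multiset of
    undirected edges are congruent and words that are identities lie in U. For the
    former, such walks differ by reversals of closed subwalks (Kotzig), and a
    subword of degree e is congruent to its image under the involution. For the
    latter, for each starting point some prefix leads out of {g_1, ..., g_n};
    cutting the word after these at most n prefixes and replacing each piece by
    one variable gives an identity of length at most n. *)

(** * Substitution homomorphisms out of the free algebra *)

Section Evaluation.
Variables (F : fieldType) (G : groupType) (A : gsAlgebra F G).
Variable v : nat -> G -> A.

Lemma gs_star0 : gs_star A 0 = 0.
Proof.
have := @gs_starP _ _ A (-1 : F) 0 0.
by rewrite scaler0 add0r scaleN1r addNr.
Qed.

Lemma gs_starD x y : gs_star A (x + y) = gs_star A x + gs_star A y.
Proof. by have := @gs_starP _ _ A (1 : F) x y; rewrite !scale1r. Qed.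

Lemma gs_starZ a x : gs_star A (a *: x) = a *: gs_star A x.
Proof. by have := @gs_starP _ _ A a x 0; rewrite !addr0 gs_star0 addr0. Qed.

Lemma gs_star1 : gs_star A 1 = 1.
Proof.
by rewrite -[RHS](@gs_starK _ _ A) -[in RHS](mulr1 (gs_star A 1)) gs_starM gs_starK mulr1.
Qed.

Lemma gs_star_sum (I : Type) (r : seq I) (P : pred I) (E : I -> A) :
  gs_star A (\sum_(i <- r | P i) E i) = \sum_(i <- r | P i) gs_star A (E i).
Proof. exact: (big_morph _ gs_starD gs_star0). Qed.

Lemma gs_comp_sum (I : eqType) (r : seq I) g (E : I -> A) :
  (forall i, i \in r -> gs_comp A g (E i)) -> gs_comp A g (\sum_(i <- r) E i).
Proof.
move=> Er; rewrite big_seq; elim/big_rec: _ => [|i x /Er Ei Ax].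
  exact: (@gs_comp0 _ _ A).
by rewrite -[E i]scale1r; apply: (@gs_compP _ _ A).
Qed.

Definition letter_val (l : letter G) : A :=
  if l.2 then gs_star A (v l.1.1 l.1.2) else v l.1.1 l.1.2.

Definition word_val (w : seq (letter G)) : A := \prod_(l <- w) letter_val l.

Definition free_eval (f : freeGS F G) : A :=
  \sum_(w <- msupp f) f@_w *: word_val w.

(** Words outside the support have coefficient 0; summing over a common larger set lets linearity be
    checked term by term. *)
Lemma free_eval_widen (d : {fset {fmonom letter G}}) (f : freeGS F G) :
  (msupp f `<=` d)%fset -> free_eval f = \sum_(w <- d) f@_w *: word_val w.
Proof.
move=> fd; rewrite /free_eval (big_fset_incl _ fd) //= => w _ wf.
by rewrite (mcoeff_outdom wf) scale0r.
Qed.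

Lemma free_eval_linear : linear free_eval.
Proof.
move=> a f g; pose d := (msupp f `|` msupp g)%fset.
rewrite (free_eval_widen (fsubsetUl _ _ : (msupp f `<=` d)%fset)).
rewrite (free_eval_widen (fsubsetUr _ _ : (msupp g `<=` d)%fset)).
rewrite (@free_eval_widen d); last first.
  apply: fsubset_trans (msuppD_le _ _) _; apply: fsetSU.
  exact: (@msuppZ_le _ _ a f).
rewrite scaler_sumr -big_split /=; apply: eq_bigr => w _.
by rewrite mcoeffD mcoeffZ scalerDl scalerA.
Qed.

Lemma free_evalU a (w : {fmonom letter G}) :
  free_eval (<< a *g w >> : free_alg F G) = a *: word_val w.
Proof.
rewrite (@free_eval_widen [fset w]%fset) ?msuppU_le //.
by rewrite big_seq_fset1 mcoeffUU.
Qed.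
HB.instance Definition _ :=
  GRing.isLinear.Build F (freeGS F G) A _ free_eval free_eval_linear.

Lemma free_eval_multiplicative : monoid_morphism free_eval.
Proof.
split.
  rewrite (_ : 1 = << (@mone _ : {fmonom letter G}) >> :> free_alg F G) //.
  by rewrite free_evalU scale1r /word_val fm1 big_nil.
move=> f g; rewrite [X in free_eval (X * _)]monalgE [X in free_eval (_ * X)]monalgE.
rewrite {2}/free_eval mulr_suml mulr_suml raddf_sum; apply: eq_bigr => u _ /=.
rewrite {2}/free_eval mulr_sumr mulr_sumr raddf_sum; apply: eq_bigr => w _ /=.
rewrite [X in free_eval X](_ : _ = << f@_u * g@_w *g mmul u w >>).
  rewrite free_evalU /word_val fmM big_cat /=.
  by rewrite -scalerAl -scalerAr scalerA.
by rewrite !malgM_def fgmulUU.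
Qed.
HB.instance Definition _ :=
  GRing.isMonoidMorphism.Build (freeGS F G) A free_eval free_eval_multiplicative.

Definition free_eval_lrmorphism : {lrmorphism freeGS F G -> A} := free_eval.

Lemma free_eval_var k g : free_eval (xvar F k g) = v k g.
Proof. by rewrite free_evalU scale1r /word_val fmU big_seq1. Qed.

Hypothesis vG : forall k g, gs_comp A g (v k g).
Hypothesis comp1 : gs_comp A 1%g 1.

Lemma word_val_star (w : seq (letter G)) :
  word_val (rev (map (@letter_star G) w)) = gs_star A (word_val w).
Proof.
elim: w => [|l w IHw]; first by rewrite /word_val !big_nil gs_star1.
rewrite /= rev_cons -cats1 /word_val big_cat big_seq1 [in RHS]big_cons gs_starM.
rewrite -/(word_val w) -IHw; congr (_ * _).
by case: l => -[k g] [] //=; rewrite /letter_val /= gs_starK.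
Qed.

(** Every graded substitution thus tests identities, and T-ideals are closed under it. The empty
    word has value 1, whence [comp1]. *)
Lemma free_eval_hom : gs_hom free_eval_lrmorphism.
Proof.
split=> [g f fg|f] /=.
  apply: gs_comp_sum => w /fg <-; rewrite -[_ *: _]addr0.
  apply: gs_compP; last exact: (@gs_comp0 _ _ A).
  rewrite /word_deg /word_val.
  elim: (w : seq _) => [|l s IHs]; last first.
    rewrite !big_cons; apply: gs_compM => //.
    by rewrite /letter_deg /letter_val; case: ifP => _ //; apply/gs_starG.
  rewrite !big_nil.
  exact: comp1.
rewrite [X in free_eval X](_ : _ = \sum_(w <- msupp f) << f@_w *g word_star w >>) //.
rewrite raddf_sum /= {2}/free_eval gs_star_sum; apply: eq_bigr => w _.
rewrite gs_starZ; have := free_evalU f@_w (word_star w) => ->.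
by rewrite word_val_star.
Qed.

End Evaluation.

(** * Walks, undirected edges and reversal of closed subwalks *)

Section Trails.
Variable G : groupType.
Implicit Types (a b c : G) (s p q r u w : seq (letter G)) (l : letter G).

Definition deg s : G := (\prod_(l <- s) letter_deg l)%g.
Definition rstar s : seq (letter G) := rev (map (@letter_star G) s).

Definition edge a l : nat * G * G := (l.1, if l.2 then (a * letter_deg l)%g else a).

(* The undirected edges traversed by the walk with label [s] that starts at [a]
   in the Cayley graph of [G]; an edge is recorded with the source of its
   non-starred orientation. *)
Fixpoint edges a s : seq (nat * G * G) :=
  if s is l :: s' then edge a l :: edges (a * letter_deg l)%g s' else [::].

Lemma deg_cons l s : deg (l :: s) = (letter_deg l * deg s)%g.
Proof. by rewrite /deg big_cons. Qed.

Lemma deg_cat s p : deg (s ++ p) = (deg s * deg p)%g.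
Proof. by rewrite /deg big_cat. Qed.

Lemma deg_nil : deg [::] = 1%g.
Proof. by rewrite /deg big_nil. Qed.

Lemma letter_deg_star l : letter_deg (letter_star l) = (letter_deg l)^-1%g.
Proof. by case: l => -[k g] [] //=; rewrite /letter_deg /= invgK. Qed.

Lemma letter_starK : involutive (@letter_star G).
Proof. by case=> x b; rewrite /letter_star /= negbK. Qed.

Lemma rstar_cat s p : rstar (s ++ p) = rstar p ++ rstar s.
Proof. by rewrite /rstar map_cat rev_cat. Qed.

Lemma rstar_cons l s : rstar (l :: s) = rstar s ++ [:: letter_star l].
Proof. by rewrite -cat1s rstar_cat. Qed.

Lemma rstarK : involutive rstar.
Proof. by move=> s; rewrite /rstar map_rev revK (mapK letter_starK). Qed.

Lemma deg_rstar s : deg (rstar s) = (deg s)^-1%g.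
Proof.
elim: s => [|l s IHs]; first by rewrite /rstar /= deg_nil invg1.
by rewrite rstar_cons deg_cat IHs !deg_cons deg_nil mulg1 letter_deg_star invgM.
Qed.

Lemma edges_cat a s p : edges a (s ++ p) = edges a s ++ edges (a * deg s)%g p.
Proof.
elim: s a => [|l s IHs] a /=; first by rewrite deg_nil mulg1.
by rewrite IHs deg_cons mulgA.
Qed.

Lemma edge_star a l : edge (a * letter_deg l)%g (letter_star l) = edge a l.
Proof.
by rewrite /edge letter_deg_star; case: l => -[k g] [] //=; rewrite mulgK.
Qed.

Lemma edges_rstar a s : edges (a * deg s)%g (rstar s) = rev (edges a s).
Proof.
elim: s a => [|l s IHs] a //=.
rewrite rstar_cons edges_cat deg_cons mulgA IHs deg_rstar mulgK /= edge_star.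
by rewrite rev_cons cats1.
Qed.

Lemma size_edges a s : size (edges a s) = size s.
Proof. by elim: s a => //= l s IHs a; rewrite IHs. Qed.

Lemma edge_inj a b l l' : edge a l = edge b l' ->
  a = b /\ l = l' \/ l' = letter_star l /\ b = (a * letter_deg l)%g.
Proof.
case: l l' => -[k g] e [[k' g'] e'] [<- <-] /=; rewrite /letter_deg /=.
case: e; case: e' => /= Eab.
- by left; split=> //; apply: mulIg Eab.
- by right; rewrite Eab.
- by right; rewrite Eab -mulgA mulVg mulg1.
- by left; rewrite Eab.
Qed.

Lemma mem_edges a s x : x \in edges a s ->
  exists p l q, s = p ++ l :: q /\ edge (a * deg p)%g l = x.
Proof.
elim: s a => [|l s IHs] a //=; rewrite inE => /predU1P[->|/IHs].
  by exists [::], l, s; rewrite deg_nil mulg1.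
case=> p [l' [q [-> <-]]]; exists (l :: p), l', q.
by rewrite deg_cons mulgA.
Qed.

Lemma mem_edges_ends a s b l : edge b l \in edges a s ->
  (exists p q, s = p ++ q /\ (a * deg p)%g = b) /\
  (exists p q, s = p ++ q /\ (a * deg p)%g = (b * letter_deg l)%g).
Proof.
case/mem_edges => p [l' [q [-> /edge_inj[[Eb ->]|[-> ->]]]]].
  split; first by exists p, (l :: q).
  by exists (p ++ [:: l]), q; rewrite -catA deg_cat mulgA Eb deg_cons deg_nil mulg1.
split; last by exists p, (l' :: q); rewrite letter_deg_star mulgK.
exists (p ++ [:: l']), q; rewrite -catA deg_cat; split=> //.
by rewrite deg_cons deg_nil mulg1 mulgA.
Qed.

(** Follow [r] from [b], which lies on [q]. As long as the next edge belongs to [q], the next vertex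
    lies on [q]; the first edge found in [p] starts at a vertex of both walks. Such an edge occurs
    since [p] is nonempty. *)
Lemma common_vertex a b p q r : edges b r =i edges a p ++ edges b q ->
  p <> [::] ->
  exists p1 p2 q1 q2,
    [/\ p = p1 ++ p2, q = q1 ++ q2 & (a * deg p1)%g = (b * deg q1)%g].
Proof.
move=> Er p0.
have [x xp xr] : exists2 x, x \in edges a p & x \in edges b r.
  case: p p0 Er => // l p _ Er; exists (edge a l); first by rewrite inE eqxx.
  by rewrite Er inE eqxx.
suff walk c q1 q2 : q = q1 ++ q2 -> (b * deg q1)%g = c -> x \in edges c r ->
    {subset edges c r <= edges a p ++ edges b q} ->
    exists p1 p2 q1 q2,
      [/\ p = p1 ++ p2, q = q1 ++ q2 & (a * deg p1)%g = (b * deg q1)%g].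
  apply: (walk b [::] q) => //; first by rewrite deg_nil mulg1.
  by move=> y; rewrite Er.
elim: r c q1 q2 {Er xr} => //= l r IHr c q1 q2 Eq Ec xr Er.
have := Er _ (mem_head _ _); rewrite mem_cat => /orP[/mem_edges_ends[] | eq].
  by case=> p1 [p2 [-> Ep]] _; exists p1, p2, q1, q2; rewrite Ep.
move: xr; rewrite inE => /predU1P[Ex|xr].
  move: xp; rewrite Ex => /mem_edges_ends[[p1 [p2 [-> Ep]]] _].
  by exists p1, p2, q1, q2; rewrite Ep.
have [_ [q1' [q2' [Eq' Ec']]]] := mem_edges_ends eq.
apply: (IHr _ q1' q2' Eq' Ec' xr) => y yr.
by apply: Er; rewrite inE yr orbT.
Qed.

(** A subword of degree e labels a closed walk from any vertex, so the relation does not mention a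
    starting point. *)
Inductive reversal : seq (letter G) -> seq (letter G) -> Prop :=
| reversal_refl s : reversal s s
| reversal_trans s p q : reversal s p -> reversal p q -> reversal s q
| reversal_step p u q : deg u = 1%g ->
    reversal (p ++ u ++ q) (p ++ rstar u ++ q).

Lemma reversal_catl p s q : reversal s q -> reversal (p ++ s) (p ++ q).
Proof.
elim=> [r|r1 r2 r3 _ IH1 _ IH2|r u r' du]; first exact: reversal_refl.
  exact: reversal_trans IH1 IH2.
by rewrite ![p ++ r ++ _]catA; apply: reversal_step.
Qed.

(** The reversed part returns to its starting vertex, so whatever follows it keeps its start and its
    edges. *)
Lemma reversal_edges a s q : reversal s q -> perm_eq (edges a s) (edges a q).
Proof.
elim=> [//|r1 r2 r3 _ IH1 _ IH2|r u r' du]; first exact: perm_trans IH1 IH2.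
rewrite !edges_cat perm_cat2l deg_rstar du invg1 perm_cat2r.
have := edges_rstar (a * deg r)%g u; rewrite du mulg1 => ->.
by rewrite perm_sym perm_rev.
Qed.

(* Kotzig's theorem on Eulerian trails. To make [s] start with the first edge
   [l] of [w], split [s = p l q]: the closed walk [p] and the walk [q] share a
   vertex, and reversing two closed subwalks through it brings [l] to the front;
   if [s] traverses [l] backwards, one reversal suffices. *)
Lemma reversal_trails a s w : perm_eq (edges a s) (edges a w) -> reversal s w.
Proof.
elim: w a s => [|l w IHw] a s Esw.
  have /perm_size := Esw; rewrite size_edges => /size0nil->.
  exact: reversal_refl.
suff [s' sls'] : exists s', reversal s (l :: s').
  apply: (reversal_trans sls'); rewrite -cat1s -[l :: w]cat1s; apply: reversal_catl.
  apply: (IHw (a * letter_deg l)%g); rewrite -(perm_cons (edge a l)).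
  by apply: perm_trans Esw; rewrite perm_sym; apply: reversal_edges sls'.
have : edge a l \in edges a s by rewrite (perm_mem Esw) mem_head.
case/mem_edges=> p [l' [q [Es /esym/edge_inj[[dp ll']|[ll' dp]]]]]; last first.
  exists (rstar p ++ q); have dp1 : deg (p ++ [:: l']) = 1%g.
    rewrite deg_cat deg_cons deg_nil mulg1 ll' letter_deg_star.
    by rewrite -(mulgI a _ _ dp) mulgV.
  have := reversal_step [::] q dp1.
  by rewrite /= -catA -Es rstar_cat ll' /rstar /= letter_starK.
rewrite -{l'}ll' in Es; have {}dp : deg p = 1%g.
  by apply: (mulgI a); rewrite mulg1 -dp.
have [p0|/eqP p0] := eqVneq p [::].
  by exists q; rewrite Es p0; apply: reversal_refl.
have [] := @common_vertex a (a * letter_deg l)%g p q w _ p0.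
  apply: perm_mem; rewrite -(perm_cons (edge a l)).
  apply: (@perm_trans _ (edges a s)); first by rewrite perm_sym.
  by rewrite Es edges_cat dp mulg1 /= -[_ :: edges _ q]cat1s perm_catCA.
move=> p1 [p2 [q1 [q2 [Ep Eq Ev]]]].
have {}Ev : deg p1 = (letter_deg l * deg q1)%g by apply: (mulgI a); rewrite mulgA.
(* With s = p1 p2 l q1 q2, the part p2 l q1 is closed. Reversing it gives p1 q1* l* p2* q2, whose
   prefix p1 q1* l* is closed; reversing that gives l q1 p1* p2* q2. *)
have d1 : deg (p2 ++ l :: q1) = 1%g.
  rewrite deg_cat deg_cons -Ev; apply: (mulgI (deg p1)).
  by rewrite mulgA -deg_cat -Ep dp mulg1 mul1g.
have d2 : deg (p1 ++ rstar q1 ++ [:: letter_star l]) = 1%g.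
  rewrite !deg_cat deg_rstar deg_cons deg_nil mulg1 letter_deg_star Ev.
  by rewrite -invgM mulgV.
exists (q1 ++ rstar p1 ++ rstar p2 ++ q2).
have := reversal_step p1 q2 d1; rewrite rstar_cat rstar_cons Es Ep Eq -!catA.
move/reversal_trans; apply.
have := reversal_step [::] (rstar p2 ++ q2) d2.
have -> : rstar (p1 ++ rstar q1 ++ [:: letter_star l]) = l :: q1 ++ rstar p1.
  by rewrite !rstar_cat rstarK /rstar /= letter_starK.
by rewrite !cat0s cat_cons -!catA.
Qed.

End Trails.

(** * Separating monomials by powers of one parameter *)

(** The weights are powers of [B]: multiplicities below [B] are digits in base [B], so the sum of
    the weights determines them. *)
Lemma digit_weights (T : eqType) (B : nat) (E : seq T) :
  exists wt : T -> nat, forall m1 m2 : seq T,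
    {subset m1 <= E} -> {subset m2 <= E} -> (size m1 < B)%N -> (size m2 < B)%N ->
    (\sum_(e <- m1) wt e = \sum_(e <- m2) wt e)%N -> perm_eq m1 m2.
Proof.
elim: E => [|a E [wt IHwt]].
  exists (fun=> 0%N) => -[|x m1] [|y m2] // m1E m2E.
  - by have := m2E y; rewrite mem_head => /(_ isT).
  - by have := m1E x; rewrite mem_head => /(_ isT).
  - by have := m1E x; rewrite mem_head => /(_ isT).
(* The head [a] takes the lowest digit: the sum modulo [B] is its multiplicity, and the quotient
   goes to the induction. *)
exists (fun e => if e == a then 1%N else (B * wt e)%N) => m1 m2 m1E m2E m1B m2B.
have sumE m : (\sum_(e <- m) (if e == a then 1 else B * wt e) =
    (\sum_(e <- [seq e <- m | e != a]) wt e) * B + count_mem a m)%N.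
  rewrite mulnC big_distrr /= big_filter -sum1_count addnC.
  rewrite [RHS](congr2 addn (big_mkcond _ _) (big_mkcond _ _)) -big_split /=.
  by apply: eq_bigr => e _; case: eqP; rewrite ?addn0.
have ltB m : (size m < B)%N -> (count_mem a m < B)%N.
  exact: leq_ltn_trans (count_size _ _).
rewrite !sumE => Em.
have := congr1 (modn^~ B) Em; rewrite !modnMDl !modn_small ?ltB // => Ea.
have splitm m : perm_eq (nseq (count_mem a m) a ++ [seq e <- m | e != a]) m.
  rewrite -size_filter; have /all_pred1P <- := filter_all (pred1 a) m.
  exact/permPl/perm_filterC.
rewrite -(permPl (splitm m1)) -(permPr (splitm m2)) Ea perm_cat2l.
have subE m : {subset m <= a :: E} -> {subset [seq e <- m | e != a] <= E}.
  by move=> mE e; rewrite mem_filter => /andP[/negbTE ea /mE]; rewrite inE ea.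
have sizeB m : (size m < B)%N -> (size [seq e <- m | e != a] < B)%N.
  by rewrite size_filter; apply: leq_ltn_trans (count_size _ _).
apply: IHwt; rewrite ?sizeB //; [exact: subE|exact: subE|].
have B0 : (0 < B)%N := leq_ltn_trans (leq0n _) m1B.
by apply/eqP; rewrite -(eqn_pmul2r B0) -(eqn_add2r (count_mem a m1)) Em Ea.
Qed.

(** A nonzero [p] has fewer than [size p] distinct roots, while an infinite field supplies [size p]
    distinct points. *)
Lemma infinite_poly0 (F : fieldType) (p : {poly F}) :
  infinite_type F -> (forall z, p.[z] = 0) -> p = 0.
Proof.
move=> Finf p0; apply/eqP; apply: contraT => pn0.
have [s us ss] : exists2 s : seq F, uniq s & size s = size p.
  elim: (size p) => [|k [s us ss]]; first by exists [::].
  have [x xs] := Finf s; exists (x :: s); first by rewrite /= xs us.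
  by rewrite /= ss.
have := max_poly_roots pn0 _ us; rewrite ss ltnn => -> //.
by apply/allP => x _; rewrite /root p0.
Qed.

(** * Monomials modulo a T-ideal *)

Section Words.
Variables (F : fieldType) (G : groupType).
Implicit Types s p q u w : seq (letter G).

Definition mon s : freeGS F G := xmon F (FMonom s).

Lemma mon_cat s p : mon (s ++ p) = mon s * mon p.
Proof.
rewrite /mon /xmon [RHS]malgM_def fgmulUU mulr1; congr << _ >>.
by apply: val_inj; rewrite /= fmM.
Qed.

Lemma mon_fmonom (w : {fmonom letter G}) : xmon F w = mon w.
Proof. by rewrite /mon fmK. Qed.

Lemma mon_letter l : xmon F (fmu l) = mon [:: l].
Proof. by rewrite /mon fmuE. Qed.

Lemma free_comp1 : gs_comp (freeGS F G) 1%g 1.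
Proof.
move=> w; have -> : (1 : freeGS F G) = << (@mone _ : {fmonom letter G}) >> by [].
by rewrite msuppU1 in_fset1 => /eqP ->; rewrite /word_deg fm1 big_nil.
Qed.

Lemma mon_nil : mon [::] = 1.
Proof.
rewrite /mon (_ : FMonom [::] = @mone {fmonom letter G}) //.
by apply: val_inj; rewrite /= fm1.
Qed.

Lemma mon_comp s : gs_comp (freeGS F G) (deg s) (mon s).
Proof. by move=> w; rewrite /mon msuppU1 in_fset1 => /eqP ->. Qed.

Lemma mon_star s : gs_star (freeGS F G) (mon s) = mon (rstar s).
Proof. exact: free_starU. Qed.

Lemma free_eval_mon (A : gsAlgebra F G) (v : nat -> G -> A) s :
  free_eval v (mon s) = word_val v s.
Proof. by rewrite free_evalU scale1r. Qed.

Lemma free_evalE (A : gsAlgebra F G) (v : nat -> G -> A) (f : freeGS F G) :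
  free_eval v f = \sum_(w <- msupp f) f@_w *: word_val v w.
Proof. by []. Qed.

Lemma Tideal_eval (I : freeGS F G -> Prop) (v : nat -> G -> freeGS F G) f :
  gs_Tideal I -> (forall k g, gs_comp (freeGS F G) g (v k g)) -> I f ->
  I (free_eval v f).
Proof. by move=> [_ HI] vG; apply: (HI _ (free_eval_hom vG free_comp1)). Qed.

(** Substituting a word [u] of degree e for x_{1,e} in generator (2) yields [mon u - mon (rstar u)];
    multiplying on both sides gives one reversal. *)
Lemma Tideal_reversal (I : freeGS F G -> Prop) s w : gs_Tideal I ->
  I (xvar F 1 1%g - xvars F 1 1%g) -> reversal s w -> I (mon s - mon w).
Proof.
move=> HI Isym; have [[I0 ID IMl IMr] _] := HI.
elim=> [r|r1 r2 r3 _ I1 _ I2|p u q du].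
- by rewrite subrr.
- by rewrite -(subrKA (mon r2)); apply: ID.
rewrite !mon_cat -mulrBr -mulrBl; apply/IMl/IMr.
(* Zero lies in every component, so this substitution is graded. *)
pose v (k : nat) (g : G) : freeGS F G := if g == 1%g then mon u else 0.
have vG k g : gs_comp (freeGS F G) g (v k g).
  by rewrite /v; case: eqP => [->|_]; [rewrite -du; apply: mon_comp|apply: free_comp0].
have := Tideal_eval HI vG Isym; rewrite raddfB /= free_eval_var /v eqxx.
rewrite [xvars _ _ _]mon_letter free_eval_mon /word_val big_seq1 /letter_val /= eqxx.
by rewrite -mon_star.
Qed.

End Words.

(** * Words whose walks leave the vertices from every start *)

(** The pieces [ss] of [w] lie between successive cut positions in increasing order; repeated
    positions give empty pieces, and [u] is the rest. *)
Lemma cut_at (T : Type) (w : seq T) (ks : seq nat) :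
  exists ss u, [/\ w = flatten ss ++ u, size ss = size ks &
    forall k, k \in ks -> exists j, take k w = flatten (take j ss)].
Proof.
(* The induction runs over the sorted positions, with the prefix up to [k0] already cut off. *)
suff walk k0 ks' : path leq k0 ks' -> exists ss u,
    [/\ w = take k0 w ++ flatten ss ++ u, size ss = size ks' &
      forall k, k \in ks' -> exists j, take k w = take k0 w ++ flatten (take j ss)].
  have [|ss [u]] := walk 0%N (sort leq ks).
    by rewrite path_min_sorted; [exact: (sort_sorted leq_total)|exact/allP].
  rewrite take0 size_sort => -[Ew Ess Ek]; exists ss, u; split=> // k kks.
  by apply: Ek; rewrite mem_sort.
elim: ks' k0 => [|k ks' IHks] k0 /=.
  by move=> _; exists [::], (drop k0 w); rewrite cat_take_drop.
case/andP=> k0k /IHks[ss [u [Ew Ess Ek]]].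
have Etk : take k w = take k0 w ++ drop k0 (take k w).
  by rewrite -[LHS](cat_take_drop k0) take_takel.
exists (drop k0 (take k w) :: ss), u; split=> /=; last 1 first.
- move=> k'; rewrite inE => /predU1P[->|/Ek[j Ej]].
    by exists 1%N; rewrite take_cons take0 /= cats0.
  by exists j.+1; rewrite Ej /= catA -Etk.
- by rewrite -catA catA -Etk.
- by rewrite Ess.
Qed.

Section Elementary.
Variables (F : fieldType) (G : groupType) (n : nat) (t : 'I_n.+1 -> G).
Implicit Types (s p q u w : seq (letter G)) (a : G) (f : freeGS F G).
Let M := elemGS F t.

(** The image of [p] is homogeneous of degree [deg p], so a nonzero entry in row i would put
    [t i * deg p] among the vertices. Row i therefore vanishes, for every i. *)
Lemma elem_identity_dead w :
  (forall i, exists p q, w = p ++ q /\ (t i * deg p)%g \notin codom t) ->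
  gs_identity M (mon F w).
Proof.
move=> dead phi [phiG _]; apply/matrixP => i j.
have [p [q [-> tip]]] := dead i.
rewrite mon_cat rmorphM !mxE big1 // => k _.
have /elem_compE pG := phiG _ _ (@mon_comp F G p).
have [->|/pG Ep] := eqVneq (phi (mon F p) i k) 0; first by rewrite mul0r.
by rewrite -Ep mulgA mulgV mul1g codom_f in tip.
Qed.

Lemma Tideal_dead (I : freeGS F G -> Prop) w : gs_Tideal I ->
  (forall y, elem_gens F t y -> I y) ->
  (forall i, exists p q, w = p ++ q /\ (t i * deg p)%g \notin codom t) ->
  I (mon F w).
Proof.
move=> HI gensI dead; have [[_ _ _ IMr] _] := HI.
have [kk kkP] : exists kk : 'I_n.+1 -> nat,
    forall i, (t i * deg (take (kk i) w))%g \notin codom t.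
  apply: (@fin_all_exists _ (fun=> nat)
    (fun i k => (t i * deg (take k w))%g \notin codom t)) => i.
  by have [p [q [-> tip]]] := dead i; exists (size p); rewrite take_size_cat.
have [ss [u [Ew sz_ss cutP]]] := cut_at w (codom kk).
(* Piece j is replaced by one variable of the same degree; the index j makes the variables distinct,
   so that each can be mapped back to its own piece. *)
pose x j : letter G := (j, deg (nth [::] ss j), false).
pose w' := mkseq x (size ss).
(* At the cuts the prefixes of [w] and [w'] have equal degree, so [w'] leaves the vertices from
   every start as well. *)
have deg_w' j : deg (take j w') = deg (flatten (take j ss)).
  rewrite /w' /mkseq -map_take take_iota.
  have -> : take j ss = mkseq (nth [::] ss) (minn j (size ss)).
    by rewrite /mkseq map_nth_iota0 ?geq_minr // take_min take_size.
  rewrite /mkseq /deg big_map big_flatten /= big_map.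
  by apply: eq_bigr => k _.
have w'I : I (mon F w').
  apply: gensI; apply: gens_mon; last first.
    apply: elem_identity_dead => i.
    have [j Ej] := cutP _ (codom_f kk i).
    exists (take j w'), (drop j w'); rewrite cat_take_drop; split=> //.
    by rewrite deg_w' -Ej.
  (* There is one cut per vertex, so [w'] has length [n.+1], which is at most [2 * n.+1 - 1]. *)
  by rewrite fdegE /= size_map size_iota sz_ss size_codom card_ord; lia.
pose v k g : freeGS F G :=
  if g == deg (nth [::] ss k) then mon F (nth [::] ss k) else 0.
have vG k g : gs_comp (freeGS F G) g (v k g).
  by rewrite /v; case: eqP => [->|_]; [apply: mon_comp|apply: free_comp0].
(* Substituting the pieces back turns [w'] into [flatten ss]; the ideal absorbs the remaining factor
   [u]. *)
have := Tideal_eval HI vG w'I; rewrite free_eval_mon /word_val big_map.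
have -> : \prod_(j <- iota 0 (size ss)) letter_val v (x j) = mon F (flatten ss).
  rewrite -[in RHS](mkseq_nth [::] ss) /mkseq.
  elim: (iota _ _) => [|j r IHr]; first by rewrite big_nil -mon_nil.
  by rewrite big_cons IHr /= mon_cat /letter_val /= /v eqxx.
by rewrite Ew mon_cat => /IMr.
Qed.

Fixpoint alive a s : bool :=
  (a \in codom t) &&
  (if s is l :: s' then alive (a * letter_deg l)%g s' else true).

Lemma dead_prefix a s : ~~ alive a s ->
  exists p q, s = p ++ q /\ (a * deg p)%g \notin codom t.
Proof.
elim: s a => [|l s IHs] a /=; rewrite negb_and ?orbF.
  by exists [::], [::]; rewrite deg_nil mulg1.
case/orP=> [a_t|/IHs[p [q [-> tp]]]].
  by exists [::], (l :: s); rewrite deg_nil mulg1.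
by exists (l :: p), q; rewrite deg_cons mulgA.
Qed.

Lemma alive_last a s : alive a s -> (a * deg s)%g \in codom t.
Proof.
elim: s a => [|l s IHs] a /=; first by rewrite andbT deg_nil mulg1.
by case/andP=> _ /IHs; rewrite deg_cons mulgA.
Qed.

Lemma alive_head a s : alive a s -> a \in codom t.
Proof. by case: s => [|l s] /andP[]. Qed.

(** * Generic matrices and the walks they record *)

Section GenericMatrix.
Variable y : nat * G * G -> F.

(** Entries are indexed by undirected edges: a starred letter, read from the transpose, meets the
    same parameter when it traverses the edge backwards. *)
Definition generic_mx k g : M :=
  \matrix_(i, j) if (t i * g)%g == t j then y (k, g, t i) else 0.

Lemma generic_mx_comp k g : gs_comp M g (generic_mx k g).
Proof.
apply/elem_compE => i j; rewrite mxE; case: (_ =P t j) => [<- _|_]; last by rewrite eqxx.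
by rewrite mulgA mulVg mul1g.
Qed.

Lemma generic_letterE l i j : letter_val generic_mx l i j =
  if (t i * letter_deg l)%g == t j then y (edge (t i) l) else 0.
Proof.
case: l => -[k g] []; rewrite /letter_val /letter_deg /edge /= !mxE //.
have -> : ((t j * g)%g == t i) = ((t i * g^-1)%g == t j).
  by apply/eqP/eqP => <-; rewrite ?mulgK // -mulgA mulVg mulg1.
by case: eqP => // ->.
Qed.

Hypothesis t_inj : injective t.

(** As the [t j] are distinct, each row of the value of a letter has at most one nonzero entry, so
    the matrix product follows a single walk. *)
Lemma generic_wordE s i j : word_val generic_mx s i j =
  if alive (t i) s && ((t i * deg s)%g == t j)
  then \prod_(e <- edges (t i) s) y e else 0.
Proof.
elim: s i => [|l s IHs] i.
  rewrite /word_val big_nil deg_nil mulg1 /= codom_f big_nil mxE (inj_eq t_inj).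
  by case: (i == j).
rewrite /word_val big_cons -/(word_val _ _) mxE /= codom_f /= deg_cons mulgA.
have [/codomP[k Ek]|nt] := boolP ((t i * letter_deg l)%g \in codom t).
  rewrite (bigD1 k) //= big1 ?addr0 => [|k' k'k].
    rewrite IHs generic_letterE Ek eqxx; case: ifP; rewrite ?mulr0 //.
    by rewrite big_cons.
  by rewrite generic_letterE Ek (inj_eq t_inj) [k == _]eq_sym (negbTE k'k) mul0r.
rewrite big1 => [|k _].
  by case: ifP => // /andP[/alive_head]; rewrite (negbTE nt).
rewrite generic_letterE; case: eqP => [E|_]; last by rewrite mul0r.
by rewrite E codom_f in nt.
Qed.

End GenericMatrix.
End Elementary.

(** * Comparison of the two ideals *)

Section Identities.
Variables (F : fieldType) (G : groupType) (n : nat) (t : 'I_n.+1 -> G).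
Implicit Types (s p q u w : {fmonom letter G}) (f : freeGS F G).
Let M := elemGS F t.

Lemma gs_hom_comp (A B C : gsAlgebra F G) (phi : {lrmorphism A -> B})
    (psi : {lrmorphism B -> C}) :
  gs_hom phi -> gs_hom psi -> gs_hom (psi \o phi : {lrmorphism A -> C}).
Proof.
move=> [phiG phiS] [psiG psiS]; split=> [g x xg|x] /=; first exact/psiG/phiG.
by rewrite phiS psiS.
Qed.

Lemma identity_Tideal (A : gsAlgebra F G) : gs_Tideal (@gs_identity F G A).
Proof.
split=> [|psi psiH f fid phi phiH]; last exact: (fid _ (gs_hom_comp psiH phiH)).
split=> [phi _|x y Ix Iy phi phiH|a x Ix phi phiH|a x Ix phi phiH].
- exact: raddf0.
- by rewrite raddfD /= Ix ?Iy ?addr0.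
- by rewrite rmorphM /= Ix ?mulr0.
- by rewrite rmorphM /= Ix ?mul0r.
Qed.

Lemma elem_comp1 : gs_comp M 1%g 1.
Proof.
apply/elem_compE => i j; rewrite mxE; case: (i =P j) => [->|_]; first by rewrite mulVg.
by rewrite eqxx.
Qed.

Hypothesis t_inj : injective t.

(** For distinct [t i], g_i^{-1} g_j = e forces i = j; that generators (1) and (2) are identities
    follows from this. *)
Lemma elem_comp1_diag (x : 'M[F]_n.+1) : elem_comp t 1%g x -> is_diag_mx x.
Proof.
move=> /elem_compE xG; apply/is_diag_mxP => i j ij.
apply/eqP; apply: contraNT ij => /xG E.
by apply/eqP; congr (val _); apply: t_inj; rewrite -[t i]mulg1 -E mulgA mulgV mul1g.
Qed.

Lemma elem_comp1_comm (x y : 'M[F]_n.+1) :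
  elem_comp t 1%g x -> elem_comp t 1%g y -> x * y - y * x = 0.
Proof.
move=> /elem_comp1_diag/diag_mxP[dx ->] /elem_comp1_diag/diag_mxP[dy ->].
by apply/eqP; rewrite subr_eq0; apply/eqP/diag_mxC.
Qed.

Lemma elem_comp1_sym (x : 'M[F]_n.+1) : elem_comp t 1%g x -> x - x^T = 0.
Proof. by move=> /elem_comp1_diag/diag_mxP[dx ->]; rewrite tr_diag_mx subrr. Qed.

Lemma gens_identity f : elem_gens F t f -> gs_identity M f.
Proof.
have var_comp k g : gs_comp (freeGS F G) g (xvar F k g).
  have := @mon_comp F G [:: (k, g, false)].
  by rewrite deg_cons deg_nil mulg1 -mon_letter.
case=> {f} [||g gS|w _ //] phi [phiG phiS]; last 1 first.
- apply/eqP; apply: contraT => /eqP nz; case: gS.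
  by exists (phi (xvar F 1 g)) => //; apply: phiG.
- rewrite (rmorphB phi) !(rmorphM phi).
  by apply: elem_comp1_comm; apply/phiG/var_comp.
have -> : xvars F 1 1%g = gs_star (freeGS F G) (xvar F 1 1%g).
  by rewrite [xvar _ _ _]mon_letter mon_star [xvars _ _ _]mon_letter.
rewrite -[RHS](elem_comp1_sym (phiG _ _ (var_comp 1%N 1%g))) (rmorphB phi).
by congr (_ - _); apply: phiS.
Qed.

Hypothesis Finf : infinite_type F.

(* Kronecker substitution: the entries of the generic matrices become powers of
   one parameter whose exponents separate the monomials of [f]. *)
Lemma identity_collision f w i : gs_identity M f -> w \in msupp f ->
  alive t (t i) w ->
  exists2 u, u \in msupp f & u != w /\ perm_eq (edges (t i) w) (edges (t i) u).
Proof.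
move=> fid wf wi; have /codomP[j Ej] := alive_last wi.
pose E := flatten [seq edges (t i) (u : seq _) | u : {fmonom letter G} <- msupp f].
pose B := (\max_(u <- msupp f) size (u : seq (letter G))).+1.
have [wt wtP] := digit_weights B E.
have edgesE u : u \in msupp f -> {subset edges (t i) u <= E}.
  by move=> uf e eu; apply/flatten_mapP; exists u.
have edgesB u : u \in msupp f -> (size (edges (t i) u) < B)%N.
  by move=> uf; rewrite size_edges ltnS; apply: leq_bigmax_seq.
pose walk u := alive t (t i) u && ((t i * deg u)%g == t j).
pose e u := (\sum_(x <- edges (t i) u) wt x)%N.
(* [P.[z]] is the entry (i, j) of [f] at the generic matrices with parameters [z ^+ wt x], where
   [t j] is the end of the walk [w]. *)
pose P : {poly F} := \sum_(u <- msupp f | walk u) f@_u *: 'X^(e u).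
have P0 : P = 0.
  apply: infinite_poly0 => // z.
  pose v := generic_mx t (fun x => z ^+ wt x).
  have vH : gs_hom (free_eval_lrmorphism v).
    by apply: free_eval_hom => [k g|]; [exact: generic_mx_comp|exact: elem_comp1].
  have /matrixP/(_ i j) := fid _ vH.
  rewrite [free_eval_lrmorphism v f]free_evalE summxE mxE => fij.
  rewrite horner_sum big_mkcond -[RHS]fij; apply: eq_bigr => u _.
  rewrite [in RHS]mxE generic_wordE // -/(walk u); case: (walk u); rewrite ?mulr0 //.
  by rewrite hornerZ hornerXn -prodrXr.
have := congr1 (fun p : {poly F} => p`_(e w)) P0.
have ww : walk w by rewrite /walk wi Ej eqxx.
rewrite coef0 coef_sum big_mkcond (bigD1_seq w) ?fset_uniq //= ww.
rewrite coefZ coefXn eqxx mulr1 => S0.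
(* The coefficient of [P] at exponent [e w] vanishes although [w] contributes [f@_w], which is
   nonzero; so another word shares the exponent and, by [wtP], the edges. *)
have [/hasP[u uf]|/hasPn no] :=
  boolP (has (fun u => (u != w) && (e u == e w)) (msupp f)).
  case/andP=> uw /eqP Eu; exists u => //; split=> //.
  by apply: wtP; rewrite ?edgesB //; apply: edgesE.
move: S0; rewrite big_seq_cond big1 => [|u /andP[uf uw]].
  by rewrite addr0 => /eqP; rewrite mcoeff_eq0 wf.
have := no _ uf; rewrite uw /= => /negbTE eu.
by rewrite coefZ coefXn eq_sym eu mulr0 if_same.
Qed.

Lemma identity_Tideal_gen f : gs_identity M f -> gs_Tideal_gen (elem_gens F t) f.
Proof.
move=> fid I HI gensI; have [[I0 ID IMl IMr] _] := HI.
have IZ a x : I x -> I (a *: x) by move=> Ix; rewrite -mulr_algl; apply: IMl.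
have [N] := ubnP #|` msupp f|; elim: N f fid => // N IHN f fid; rewrite ltnS => fN.
have [->|] := eqVneq f 0; first exact: I0.
rewrite -msupp_eq0 => /fset0Pn[w wf].
(* Subtracting a multiple of such an [h] removes [w] and adds no word, so the support shrinks; the
   difference stays an identity because the generated ideal consists of identities. *)
have step (h : freeGS F G) : gs_Tideal_gen (elem_gens F t) h -> h@_w = 1 ->
    (msupp h `<=` msupp f)%fset -> I f.
  move=> Uh hw hf; rewrite -(subrK (f@_w *: h) f); apply: ID; last exact/IZ/(Uh _ HI gensI).
  have hid : gs_identity M h by apply: Uh => [|y]; [apply: identity_Tideal|apply: gens_identity].
  apply: IHN.
    move=> phi phiH; rewrite (rmorphB phi) -mulr_algl (rmorphM phi).
    by rewrite [X in X - _]fid // [X in _ * X]hid // mulr0 subr0.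
  apply: leq_trans fN; apply: fproper_ltn_card; rewrite fproperE; apply/andP; split.
    apply/fsubsetP => u.
    rewrite -!mcoeff_neq0 mcoeffB mcoeffZ; apply: contra => /eqP fu0.
    rewrite fu0 sub0r oppr_eq0 mulf_eq0; apply/orP; right.
    rewrite mcoeff_eq0; apply/negP => uh.
    by have := fsubsetP hf u uh; rewrite -mcoeff_neq0 fu0 eqxx.
  apply/negP => /fsubsetP/(_ _ wf).
  by rewrite -mcoeff_neq0 mcoeffB mcoeffZ hw mulr1 subrr eqxx.
(* If [w] survives from some vertex, [h] is its difference with a colliding word [u]; otherwise [w]
   itself lies in the ideal. *)
have [/existsP[i wi]|/existsPn dead] := boolP [exists i, alive t (t i) w].
  have [u uf [uw Euw]] := identity_collision fid wf wi.
  apply: (step (xmon F w - xmon F u)).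
  - move=> J HJ gensJ; rewrite !mon_fmonom.
    apply: Tideal_reversal => //; first exact/gensJ/gens_sym.
    exact: reversal_trails Euw.
  - by rewrite mcoeffB !mcoeffU1 eqxx (negbTE uw) subr0.
  - apply: fsubset_trans (msuppB_le _ _) _; rewrite !msuppU1.
    by apply/fsubsetP => x; rewrite in_fsetU !in_fset1 => /orP[]/eqP->.
apply: (step (xmon F w)).
- move=> J HJ gensJ; rewrite mon_fmonom; apply: (Tideal_dead HJ gensJ) => i.
  exact/dead_prefix/dead.
- by rewrite mcoeffU1 eqxx.
- by rewrite msuppU1 fsub1set.
Qed.

End Identities.

Theorem theorem4p7 (F : fieldType) (G : groupType) (n : nat)
    (t : 'I_n.+1 -> G) :
  infinite_type F -> injective t ->
  forall f : freeGS F G,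
    gs_identity (elemGS F t) f <-> gs_Tideal_gen (elem_gens F t) f.
Proof.
move=> Finf t_inj f; split; first exact: identity_Tideal_gen.
by apply; [apply: identity_Tideal|apply: gens_identity].
Qed.
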